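(* Let $0<q<1$, $N\ge1$, and let $A,B,C\in\mathrm{Mat}_N(\mathbb{C})$ be such that $\sigma(C)\cap q^{-\mathbb{N}\setminus\{0\}}=\emptyset$. For every row vector $F^0\in\mathbb{C}^N$, the function $$F(z)=F^0\;{}_2\eta_1\biggl[\genfrac..{0pt}{}{A,B}{C};q,qz\biggr]$$ is a solution of the matrix-valued $q$-difference equation $$F(q^{-1}z)(1-z)+F(z)\left(-I-C+zA\right)+F(qz)\left(C+zB\right)=0$$ with $F(0)=F^0$. Conversely, any (row-vector-valued) solution $F$ of this equation that is analytic around $z=0$ and has initial value $F(0)\neq0$ is of the form $F(z)=F^0\;{}_2\eta_1\bigl[\genfrac..{0pt}{}{A,B}{C};q,qz\bigr]$ with $F^0\in\mathbb{C}^N$ a row vector.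
   Context: $\sigma(C)$ is the spectrum of $C$ and $q^{-\mathbb{N}\setminus\{0\}}=\{q^{-n}:n=1,2,\dots\}$. Define $(A,B;C;q)_0=I$ and, for $k\ge1$, $$(A,B;C;q)_k=(A,B;C;q)_{k-1}\left(I-q^{k-1}A-q^{2k-2}B\right)\left(I-q^kC\right)^{-1},$$ and $${}_2\eta_1\biggl[\genfrac..{0pt}{}{A,B}{C};q,z\biggr]=\sum_{n=0}^\infty (A,B;C;q)_n\frac{z^n}{(q;q)_n},$$ which converges for $|z|<1$ in the norm of $\mathrm{Mat}_N(\mathbb{C})$. Here $(q;q)_n=\prod_{i=1}^n(1-q^i)$. *)

(* Defs.v *)
From mathcomp Require Import all_boot all_order all_algebra.
From mathcomp Require Import all_classical all_reals all_analysis.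

Set Implicit Arguments.
Unset Strict Implicit.
Unset Printing Implicit Defensive.

Import Order.TTheory GRing.Theory Num.Theory.
Import numFieldNormedType.Exports.

Local Open Scope classical_set_scope.
Local Open Scope ring_scope.

(* Everything is stated over a numFieldType K, meant to be instantiated by the
   complex numbers R[i]; limits of matrices are for the maximum norm. *)
Section TwoEtaOne.
Variables (K : numFieldType) (N : nat).
Implicit Types (q z r : K) (A B C : 'M[K]_N) (F : K -> 'rV[K]_N).

Definition spectrum C : set K := [set a | eigenvalue C a].

Definition qfact q (n : nat) : K := \prod_(1 <= i < n.+1) (1 - q ^+ i).

Fixpoint eta_poch A B C q (k : nat) : 'M[K]_N :=
  if k is k'.+1 then
    eta_poch A B C q k'
      *m (1%:M - q ^+ k' *: A - q ^+ (2 * k') *: B)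
      *m invmx (1%:M - q ^+ k *: C)
  else 1%:M.

Definition eta21 A B C q z : 'M[K]_N :=
  limn (fun n => \sum_(0 <= k < n) (z ^+ k / qfact q k) *: eta_poch A B C q k).

Definition qdiff_eq A B C q F z : Prop :=
  (1 - z) *: F (q^-1 * z) + F z *m (- 1%:M - C + z *: A)
    + F (q * z) *m (C + z *: B) = 0.

(* F is analytic around 0, its Taylor series at 0 having sum F on the whole
   open disc of radius r. *)
Definition analytic_on_disc r F : Prop :=
  exists f : nat -> 'rV[K]_N, forall z, `|z| < r ->
    (\sum_(0 <= k < n) z ^+ k *: f k) @[n --> \oo] --> F z.

End TwoEtaOne.

(* Main.v *)
Require Import Defs.
From mathcomp Require Import all_boot all_order all_algebra.
From mathcomp Require Import all_classical all_reals all_analysis.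
From mathcomp Require Import complex ring lra.

(** The equation is a statement about Taylor coefficients.  Substituting
    F(z) = sum_k f_k z^k and comparing the coefficients of z^(k+1) gives

      (q^-(k+1) - 1) f_(k+1) (I - q^(k+1) C)
        = q^-k f_k (I - q^k A - q^(2k) B),

    while the constant term f_0 - f_0 (I + C) + f_0 C vanishes identically.
    Since C has no eigenvalue q^-n with n >= 1, every matrix I - q^(k+1) C is
    invertible, so f_0 determines all the f_k ([residual_inj]); and the
    coefficients q^k f_0 (A,B;C;q)_k / (q;q)_k solve this recurrence
    ([residual_eta_coef]).

    Both directions of the passage between F and its coefficients rest on one
    finite identity, [psum_residual]: the operator of the equation, applied to
    the partial sums of a power series, is z times the partial sum of the series
    whose coefficients are the defects of the recurrence.  It is exact because
    the partial sums multiplied by z in the equation are taken one term shorter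
    than the others.  Passing to the limit ([cvg_psum_residual]):
    - if the recurrence holds, the right-hand side is zero, so the sum of the
      series solves the equation wherever the three series converge;
    - if F is analytic and solves the equation near 0, the defects are the
      coefficients of a power series with sum zero on a punctured disc, so they
      vanish by the identity theorem [psum_coef0], and F is F(0) times the
      series.

    Convergence for |z| < 1 is a ratio test: the recurrence bounds the ratio of
    consecutive coefficient norms by a quantity tending to 1
    ([ratio_estimate]), so the terms are dominated by a geometric sequence
    ([eta_coef_growth]).  The factors (I - q^k C)^-1 are handled by the inverse
    triangle inequality, which bounds v by v (I - q^k C) once q^k is small.

    The estimates use the sum of the moduli of the entries of a matrix as norm.
    It takes real values, so that real arithmetic applies, it is
    submultiplicative, and it defines the same convergence as the maximum
    norm ([cvg_mnormP]). *)

Set Implicit Arguments.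
Unset Strict Implicit.
Unset Printing Implicit Defensive.

Import Order.TTheory GRing.Theory Num.Theory.
Import numFieldNormedType.Exports.

Local Open Scope classical_set_scope.
Local Open Scope ring_scope.
Local Open Scope complex_scope.

Import Normc.

(** * A real-valued submultiplicative norm on complex matrices *)

(** Stated over an abstract numeric field, which is what gives the matrix space
    its topology; complex matrices enter by unifying [K] with [R[i]]. *)
Definition mx_cvg (K : numFieldType) m n
    (u : nat -> 'M[K]_(m, n)) (l : 'M[K]_(m, n)) : Prop :=
  u k @[k --> \oo] --> l.

Section MatrixNorm.
Variable R : realType.

Lemma norm_normc (z : R[i]) : `|z| = (normc z)%:C.
Proof. by []. Qed.

Lemma normc_ge0 (z : R[i]) : 0 <= normc z.
Proof. by rewrite -ler0c -norm_normc. Qed.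

Lemma normc_real (x : R) : normc x%:C = `|x|.
Proof. by rewrite /normc/= expr0n/= addr0 sqrtr_sqr. Qed.

Lemma normcX (z : R[i]) k : normc (z ^+ k) = normc z ^+ k.
Proof. by elim: k => [|k IH]; rewrite ?normc1// !exprS normcM IH. Qed.

Lemma normc_le_ReIm (z : R[i]) : normc z <= `|complex.Re z| + `|complex.Im z|.
Proof.
rewrite {1}(complexE z); apply: (le_trans (le_normcD _ _)).
by rewrite normcM !normc_real /normc/= expr0n/= expr1n add0r sqrtr1 mul1r.
Qed.

Lemma normRe_le (z : R[i]) : `|complex.Re z| <= normc z.
Proof. by have := normc_ge_Re z; rewrite norm_normc lecR. Qed.

Lemma normIm_le (z : R[i]) : `|complex.Im z| <= normc z.
Proof.
rewrite -normrN -ReiNIm; apply: (le_trans (normRe_le _)).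
by rewrite normcM /normc/= expr0n/= expr1n add0r sqrtr1 mulr1.
Qed.

Lemma Re_sum (I : Type) (s : seq I) (f : I -> R[i]) :
  complex.Re (\sum_(i <- s) f i) = \sum_(i <- s) complex.Re (f i).
Proof. by apply: big_morph => // -[a b] [c d]. Qed.

Lemma Im_sum (I : Type) (s : seq I) (f : I -> R[i]) :
  complex.Im (\sum_(i <- s) f i) = \sum_(i <- s) complex.Im (f i).
Proof. by apply: big_morph => // -[a b] [c d]. Qed.

Definition mnorm m n (M : 'M[R[i]]_(m, n)) : R := \sum_i \sum_j normc (M i j).

Lemma mnorm_ge0 m n (M : 'M[R[i]]_(m, n)) : 0 <= mnorm M.
Proof. by apply: sumr_ge0 => i _; apply: sumr_ge0 => j _; exact: normc_ge0. Qed.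

Lemma normc_le_mnorm m n (M : 'M[R[i]]_(m, n)) i j : normc (M i j) <= mnorm M.
Proof.
rewrite /mnorm (bigD1 i)//= (bigD1 j)//= -addrA lerDl addr_ge0//.
  by apply: sumr_ge0 => ? _; exact: normc_ge0.
by apply: sumr_ge0 => ? _; apply: sumr_ge0 => ? _; exact: normc_ge0.
Qed.

Lemma mnorm_eq0 m n (M : 'M[R[i]]_(m, n)) : mnorm M = 0 -> M = 0.
Proof.
move=> M0; apply/matrixP => i j; rewrite mxE; apply: eq0_normc; apply/le_anti.
by rewrite normc_ge0 -M0 normc_le_mnorm.
Qed.

Lemma mnorm0 m n : mnorm (0 : 'M[R[i]]_(m, n)) = 0.
Proof.
by rewrite /mnorm big1// => i _; rewrite big1// => j _; rewrite mxE normc0.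
Qed.

Lemma mnormD m n (M1 M2 : 'M[R[i]]_(m, n)) :
  mnorm (M1 + M2) <= mnorm M1 + mnorm M2.
Proof.
rewrite /mnorm -big_split/=; apply: ler_sum => i _.
rewrite -big_split/=; apply: ler_sum => j _.
by rewrite mxE le_normcD.
Qed.

Lemma mnormZ m n (a : R[i]) (M : 'M[R[i]]_(m, n)) :
  mnorm (a *: M) = normc a * mnorm M.
Proof.
rewrite /mnorm mulr_sumr; apply: eq_bigr => i _.
by rewrite mulr_sumr; apply: eq_bigr => j _; rewrite mxE normcM.
Qed.

Lemma mnormN m n (M : 'M[R[i]]_(m, n)) : mnorm (- M) = mnorm M.
Proof.
by apply: eq_bigr => i _; apply: eq_bigr => j _; rewrite mxE normcN.
Qed.

Lemma mnormB m n (M1 M2 : 'M[R[i]]_(m, n)) :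
  mnorm (M1 - M2) <= mnorm M1 + mnorm M2.
Proof. by rewrite (le_trans (mnormD _ _))// mnormN. Qed.

Lemma mnorm_sum m n (I : Type) (s : seq I) (f : I -> 'M[R[i]]_(m, n)) :
  mnorm (\sum_(i <- s) f i) <= \sum_(i <- s) mnorm (f i).
Proof.
elim/big_ind2 : _ => [|M1 a M2 b le1 le2|//]; first by rewrite mnorm0.
by rewrite (le_trans (mnormD _ _)) ?lerD.
Qed.

Lemma normc_sum (I : Type) (s : seq I) (f : I -> R[i]) :
  normc (\sum_(i <- s) f i) <= \sum_(i <- s) normc (f i).
Proof.
elim/big_ind2 : _ => [|M1 a M2 b le1 le2|//]; first by rewrite normc0.
by rewrite (le_trans (le_normcD _ _)) ?lerD.
Qed.

Lemma mnormM m n p (M1 : 'M[R[i]]_(m, n)) (M2 : 'M[R[i]]_(n, p)) :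
  mnorm (M1 *m M2) <= mnorm M1 * mnorm M2.
Proof.
rewrite /mnorm mulr_suml; apply: ler_sum => i _.
rewrite mulr_suml.
apply: (@le_trans _ _
  (\sum_j \sum_k normc (M1 i k) * normc (M2 k j))).
  apply: ler_sum => j _; rewrite mxE (le_trans (normc_sum _ _))//.
  by apply: ler_sum => k _; rewrite normcM.
rewrite exchange_big; apply: ler_sum => k _; rewrite -mulr_sumr.
rewrite ler_wpM2l ?normc_ge0//.
rewrite [leRHS](bigD1 k)//= lerDl.
by apply: sumr_ge0 => ? _; apply: sumr_ge0 => ? _; exact: normc_ge0.
Qed.

Lemma mx_norm_le_mnorm m n (M : 'M[R[i]]_(m, n)) : `|M| <= (mnorm M)%:C.
Proof.
have [->|/mx_norm_neq0[ij]] := eqVneq `|M| 0; first by rewrite ler0c mnorm_ge0.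
by rewrite -[mx_norm M]/(`|M|) => ->; rewrite norm_normc lecR normc_le_mnorm.
Qed.

Lemma normc_le_mx_norm m n (M : 'M[R[i]]_(m, n)) i j :
  (normc (M i j))%:C <= `|M|.
Proof.
rewrite -norm_normc [leRHS]/Num.Def.normr/= mx_normE.
rewrite -[leLHS]nngE num_le.
by apply: (le_bigmax _ (fun k => `|M k.1 k.2|%:nng) (i, j)).
Qed.

(** Each entry is bounded by the maximum norm, and the maximum norm by the sum
    of the moduli of the entries; hence both norms define the same limits. *)
Lemma cvg_mnormP m n (u : nat -> 'M[R[i]]_(m, n)) (l : 'M[R[i]]_(m, n)) :
  mx_cvg u l <-> mnorm (u k - l) @[k --> \oo] --> (0 : R).
Proof.
rewrite /mx_cvg; split=> [ul|ul].
  have -> : (0 : R) = \sum_(i < m) \sum_(j < n) 0.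
    by rewrite big1// => i _; rewrite big1.
  apply: cvg_big => [|i _]; first exact: add_continuous.
  apply: cvg_big => [|j _]; first exact: add_continuous.
  apply/cvgr0Pnorm_lt => e e0.
  have e0C : 0 < e%:C by rewrite ltcR.
  move/cvgrPdistC_lt : ul => /(_ _ e0C); apply: filterS => k.
  rewrite ger0_norm ?normc_ge0// -ltcR; apply: le_lt_trans.
  exact: normc_le_mx_norm.
apply/cvgrPdistC_lt => e e0.
have eE : e = (complex.Re e)%:C by rewrite RRe_real// gtr0_real.
rewrite eE ltcR in e0 *.
move/cvgr0Pnorm_lt : ul => /(_ _ e0); apply: filterS => k.
rewrite ger0_norm ?mnorm_ge0// -ltcR; apply: le_lt_trans.
exact: mx_norm_le_mnorm.
Qed.

Lemma cvg_mulmxr m n p (u : nat -> 'M[R[i]]_(m, n)) l (A : 'M[R[i]]_(n, p)) :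
  mx_cvg u l -> mx_cvg (fun k => u k *m A) (l *m A).
Proof.
move=> /cvg_mnormP ul; apply/cvg_mnormP.
apply: (@squeeze_cvgr _ _ _ _ (fun=> 0) (fun k => mnorm (u k - l) * mnorm A)).
- by near=> k; rewrite mnorm_ge0 -mulmxBl mnormM.
- exact: cvg_cst.
- by rewrite -(mul0r (mnorm A)); apply: cvgMr_tmp.
Unshelve. all: by end_near. Qed.

Lemma cvg_mulmxl m n p (A : 'M[R[i]]_(m, n)) (u : nat -> 'M[R[i]]_(n, p)) l :
  mx_cvg u l -> mx_cvg (fun k => A *m u k) (A *m l).
Proof.
move=> /cvg_mnormP ul; apply/cvg_mnormP.
apply: (@squeeze_cvgr _ _ _ _ (fun=> 0) (fun k => mnorm A * mnorm (u k - l))).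
- by near=> k; rewrite mnorm_ge0 -mulmxBr mnormM.
- exact: cvg_cst.
- by rewrite -(mulr0 (mnorm A)); apply: cvgMl_tmp.
Unshelve. all: by end_near. Qed.

End MatrixNorm.

Section GenericLimits.
Variables (K : numFieldType) (m n : nat).
Implicit Types u v : nat -> 'M[K]_(m, n).

Lemma cvg_mx_unique u l l' : mx_cvg u l -> mx_cvg u l' -> l = l'.
Proof. by move=> ul ul'; apply: cvg_unique ul ul'; exact: norm_hausdorff. Qed.

Lemma cvg_mxD u v l l' :
  mx_cvg u l -> mx_cvg v l' -> mx_cvg (fun k => u k + v k) (l + l').
Proof. exact: cvgD. Qed.

Lemma cvg_mxZ (a : K) u l : mx_cvg u l -> mx_cvg (fun k => a *: u k) (a *: l).
Proof. exact: cvgZl_tmp. Qed.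

Lemma cvg_mxS u l : mx_cvg u l -> mx_cvg (fun k => u k.+1) l.
Proof. by rewrite /mx_cvg => ul; rewrite cvg_shiftS. Qed.

Lemma cvg_mx_lim u l : mx_cvg u l -> limn u = l.
Proof. by move=> ul; apply: cvg_lim ul; exact: norm_hausdorff. Qed.

End GenericLimits.

(** * Power series with matrix coefficients *)

Section PowerSeries.
Variable R : realType.

Definition psum (K : numFieldType) m n (f : nat -> 'M[K]_(m, n)) (z : K) k :=
  \sum_(0 <= j < k) z ^+ j *: f j.

Lemma cvg_real_dominated (a : nat -> R) (M x : R) : 0 <= x < 1 ->
  (forall k, `|a k| <= M * x ^+ k) -> cvgn (series a).
Proof.
move=> /andP[x0 x1] aM; apply: normed_cvg.
apply: (@series_le_cvg _ _ (geometric M x)) => //=.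
- by move=> k; apply: le_trans (aM k).
- by apply: is_cvg_geometric_series; rewrite ger0_norm.
Qed.

(** The limit is built entry by entry: the real and imaginary parts of each
    entry form real series dominated by the same geometric series. *)
Lemma cvg_mx_dominated m n (a : nat -> 'M[R[i]]_(m, n)) (M x : R) :
  0 <= x < 1 -> (forall k, mnorm (a k) <= M * x ^+ k) ->
  exists l, mx_cvg (fun k => \sum_(0 <= j < k) a j) l.
Proof.
move=> x01 aM.
have cRe i j : cvgn (series (fun k => complex.Re (a k i j))).
  apply: (cvg_real_dominated x01) => k; apply: le_trans (aM k).
  apply: le_trans (normc_le_mnorm _ i j); exact: normRe_le.
have cIm i j : cvgn (series (fun k => complex.Im (a k i j))).
  apply: (cvg_real_dominated x01) => k; apply: le_trans (aM k).
  apply: le_trans (normc_le_mnorm _ i j).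
  exact: normIm_le.
exists (\matrix_(i, j) (limn (series (fun k => complex.Re (a k i j)))
  +i* limn (series (fun k => complex.Im (a k i j))))).
have cvg_dist (u : nat -> R) :
    cvgn u -> `|u k - limn u| @[k --> \oo] --> (0 : R).
  move=> cu; apply/cvgr0Pnorm_lt => e e0; near do rewrite normr_id.
  by move/cvgrPdistC_lt : cu; apply.
apply/cvg_mnormP.
have -> : (0 : R) = \sum_(i < m) \sum_(j < n) (0 + 0).
  by rewrite big1// => i _; rewrite big1// => j _; rewrite addr0.
apply: (@squeeze_cvgr _ _ _ _ (fun=> 0) (fun k => \sum_(i < m) \sum_(j < n)
  (`|series (fun k => complex.Re (a k i j)) k
     - limn (series (fun k => complex.Re (a k i j)))|
  + `|series (fun k => complex.Im (a k i j)) k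
     - limn (series (fun k => complex.Im (a k i j)))|))).
- near=> k; rewrite mnorm_ge0/=; apply: ler_sum => i _; apply: ler_sum => j _.
  rewrite !mxE; apply: (le_trans (normc_le_ReIm _)).
  by rewrite summxE /series/= -Re_sum -Im_sum; case: (\sum_(_ <= _ < _) _).
- rewrite big1; first exact: cvg_cst.
  by move=> i _; rewrite big1// => j _; rewrite addr0.
- apply: cvg_big => [|i _]; first exact: add_continuous.
  apply: cvg_big => [|j _]; first exact: add_continuous.
  by apply: cvgD; apply: cvg_dist.
Unshelve. all: by end_near.
Qed.

Lemma cvg_psum_at0 m n (f : nat -> 'M[R[i]]_(m, n)) l :
  mx_cvg (psum f 0) l -> l = f 0.
Proof.
move=> /cvg_mxS fl; apply: (cvg_mx_unique fl).
rewrite (_ : (fun _ => _) = fun=> f 0); first exact: cvg_cst.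
apply/funext => k; rewrite /psum big_nat_recl// expr0 scale1r.
by rewrite big1 ?addr0// => j _; rewrite expr0n scale0r.
Qed.

(** Convergence at one point [s] bounds [s ^+ k * mnorm (f k)] by a constant
    [M]; at the point [s * x] with [x <= 1 / 2], the terms of index at least 1
    then add up to at most [2 * M * x], and [f 0] must compensate them.
    Let [x] tend to 0. *)
Lemma psum0_coef0 m n (f : nat -> 'M[R[i]]_(m, n)) (d : R) : 0 < d ->
  (forall z, 0 < normc z < d -> mx_cvg (psum f z) 0) -> f 0 = 0.
Proof.
move=> d0 f0; set s := d / 2.
have s0 : 0 < s by rewrite divr_gt0.
have sd : s < d by rewrite /s; lra.
have bnd : exists2 M : R, 0 <= M & forall k, s ^+ k * mnorm (f k) <= M.
  have : mx_cvg (psum f s%:C) 0 by apply: f0; rewrite normc_real gtr0_norm ?s0.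
  move=> /cvg_mnormP/cvgP/cvg_seq_bounded/pinfty_ex_gt0[M M0 /= fM].
  have {}fM k : mnorm (psum f s%:C k) <= M.
    by have := fM k I; rewrite subr0 ger0_norm ?mnorm_ge0.
  exists (M + M) => [|k]; first by rewrite addr_ge0 ?ltW.
  have -> : s ^+ k * mnorm (f k) = mnorm (psum f s%:C k.+1 - psum f s%:C k).
    rewrite /psum big_nat_recr//= addrAC subrr add0r mnormZ normcX normc_real.
    by rewrite gtr0_norm.
  by rewrite (le_trans (mnormB _ _))// lerD.
have [M M0 fM] := bnd.
have key (x : R) : 0 < x <= 1 / 2 -> mnorm (f 0) <= 2 * M * x.
  move=> /andP[x0 x1]; have z01 : 0 < normc (s * x)%:C < d.
    by rewrite normc_real gtr0_norm ?mulr_gt0//=; nra.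
  have /cvg_mnormP := cvg_mxS (f0 _ z01).
  under eq_cvg do rewrite subr0.
  move=> c0.
  suff : forall k, mnorm (f 0) - 2 * M * x <= mnorm (psum f (s * x)%:C k.+1).
    move=> le; rewrite -subr_le0; apply: cvgr_to_ge c0 _.
    by apply: nearW.
  move=> k.
  have -> : f 0 = psum f (s * x)%:C k.+1 -
     \sum_(0 <= j < k) (s * x)%:C ^+ j.+1 *: f j.+1.
    by rewrite /psum big_nat_recl// addrK expr0 scale1r.
  rewrite lerBlDr (le_trans (mnormB _ _))// lerD2l.
  apply: (le_trans (mnorm_sum _ _)).
  apply: (@le_trans _ _ (\sum_(0 <= j < k) M * x * x ^+ j)).
    apply: ler_sum => j _.
    rewrite mnormZ normcX normc_real gtr0_norm ?mulr_gt0//.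
    by rewrite exprMn mulrAC -[leRHS]mulrA -exprS ler_wpM2r// exprn_ge0// ltW.
  have x_lt1 : `|x| < 1 by rewrite gtr0_norm//; lra.
  apply: (le_trans (geometric_le_lim _ _ x0 x_lt1)).
    exact: mulr_ge0 (ltW x0).
  rewrite ler_pdivrMr; last by lra.
  have Mx0 : 0 <= M * x by exact: mulr_ge0 (ltW x0).
  by nra.
apply: mnorm_eq0; apply/le_anti; rewrite mnorm_ge0 andbT.
rewrite leNgt; apply/negP => f0_gt0.
(* This [x] is at most 1/2, and makes 2 M x at most half of mnorm (f 0). *)
have D0 : 0 < 4 * M + 2 * mnorm (f 0) by lra.
have := key (mnorm (f 0) / (4 * M + 2 * mnorm (f 0))).
rewrite divr_gt0//= ler_pdivrMr// mulrA ler_pdivlMr//.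
by move=> le; have := le ltac:(lra); nra.
Qed.

(** Identity theorem for power series: once [f 0 = 0], dividing by [z] gives the
    series of the shifted coefficients, again with sum zero off the origin.
    This is why the disc is punctured. *)
Lemma psum_coef0 m n (f : nat -> 'M[R[i]]_(m, n)) (d : R) : 0 < d ->
  (forall z, 0 < normc z < d -> mx_cvg (psum f z) 0) -> forall k, f k = 0.
Proof.
move=> d0 + k; elim: k f => [|k IH] f f0; first exact: psum0_coef0 f0.
apply: (IH (fun j => f j.+1)) => z zd.
have z0 : z != 0 by apply: contraTneq zd => ->; rewrite normc0 ltxx.
have -> : psum (fun j => f j.+1) z = fun j => z^-1 *: psum f z j.+1.
  apply/funext => j; rewrite /psum big_nat_recl// (psum0_coef0 d0 f0) scaler0.
  rewrite add0r scaler_sumr; apply: eq_bigr => l _.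
  by rewrite scalerA exprS mulKf.
rewrite -(scaler0 _ z^-1); apply: cvg_mxZ; apply: cvg_mxS; exact: f0.
Qed.

End PowerSeries.

(** * The recurrence for the Taylor coefficients *)

Section Recurrence.
Variables (K : numFieldType) (N : nat) (A B C : 'M[K]_N) (q : K).
Hypothesis q_neq0 : q != 0.
Hypothesis q_not_root1 : forall k, q ^+ k.+1 != 1.
Hypothesis unitC : forall k, 1%:M - q ^+ k.+1 *: C \in unitmx.

(** The defect in the recurrence satisfied by the Taylor coefficients of a
    solution: the coefficient of z^(k+1) in the equation for the series with
    coefficients [f]. *)
Definition residual m (f : nat -> 'M[K]_(m, N)) k : 'M[K]_(m, N) :=
  (q ^- k.+1 - 1) *: (f k.+1 *m (1%:M - q ^+ k.+1 *: C))
  - q ^- k *: (f k *m (1%:M - q ^+ k *: A - q ^+ (2 * k) *: B)).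

Lemma psumS m (f : nat -> 'M[K]_(m, N)) z k :
  psum f z k.+1 = psum f z k + z ^+ k *: f k.
Proof. by rewrite /psum big_nat_recr. Qed.

(** The equation for partial sums, exact at every finite stage.  The summands
    carrying a factor [z] are truncated one term earlier, so that both sides
    are polynomials in [z] of the same degree, and the constant terms cancel. *)
Lemma psum_residual m (f : nat -> 'M[K]_(m, N)) z k :
  psum f (q^-1 * z) k.+1 - z *: psum f (q^-1 * z) k
  + (psum f z k.+1 *m (- 1%:M - C) + z *: (psum f z k *m A))
  + (psum f (q * z) k.+1 *m C + z *: (psum f (q * z) k *m B))
  = z *: psum (residual f) z k.
Proof.
elim: k => [|k IH].
  rewrite !psumS /psum !big_geq// !mul0mx !scaler0 subr0 !addr0 !add0r !expr0.
  by rewrite !scale1r mulmxBr mulmxN mulmx1 addrA subrr sub0r addNr.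
rewrite [in RHS]psumS scalerDr -IH !psumS.
move: (psum f (q^-1 * z) k) (psum f z k) (psum f (q * z) k) => P1 P2 P3.
rewrite /residual; move: (f k.+1) (f k) => X Y.
rewrite !(mulmxDl, mulmxDr, mulmxBr, mulmxN, mulmx1) -?scalemxAl -?scalemxAr.
rewrite -?scalemxAl.
move: (P2 *m A) (P2 *m C) (P3 *m B) (P3 *m C) => P2A P2C P3B P3C.
move: (X *m C) (Y *m A) (Y *m B) (Y *m C) => XC YA YB YC.
apply/matrixP => i j; rewrite !mxE.
rewrite !exprMn !exprVn !exprS mulnC exprM expr2.
have qk0 : q ^+ k != 0 by rewrite expf_neq0.
by field; rewrite qk0.
Qed.

(** The recurrence can be solved for its last term because
    [1%:M - q ^+ k.+1 *: C] is invertible and [q ^+ k.+1 != 1]. *)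
Lemma residual_inj m (f g : nat -> 'M[K]_(m, N)) :
  (forall k, residual f k = 0) -> (forall k, residual g k = 0) ->
  f 0 = g 0 -> f =1 g.
Proof.
move=> f0 g0 fg0; elim=> [//|k fgk].
have c_neq0 : q ^- k.+1 - 1 != 0 by rewrite subr_eq0 invr_eq1.
apply: (can_inj (mulmxK (unitC k))); apply: (scalerI c_neq0).
have /eqP := f0 k; rewrite subr_eq0 => /eqP ->.
by have /eqP := g0 k; rewrite subr_eq0 => /eqP ->; rewrite fgk.
Qed.

Definition eta_coef k : 'M[K]_N := (qfact q k)^-1 *: eta_poch A B C q k.

Lemma eta_coef0 : eta_coef 0 = 1%:M.
Proof. by rewrite /eta_coef /qfact big_geq// invr1 scale1r. Qed.

Lemma eta_coefS k :
  (1 - q ^+ k.+1) *: (eta_coef k.+1 *m (1%:M - q ^+ k.+1 *: C))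
  = eta_coef k *m (1%:M - q ^+ k *: A - q ^+ (2 * k) *: B).
Proof.
have c_neq0 : 1 - q ^+ k.+1 != 0 by rewrite subr_eq0 eq_sym.
rewrite /eta_coef /= -!scalemxAl mulmxKV// scalerA; congr (_ *: _).
by rewrite /qfact [in LHS]big_nat_recr//= invfM mulrCA divff ?mulr1.
Qed.

Lemma residual_eta_coef m (F0 : 'M[K]_(m, N)) k :
  residual (fun j => F0 *m (q ^+ j *: eta_coef j)) k = 0.
Proof.
rewrite /residual; move: (eta_coefS k).
move: (eta_coef k.+1) (eta_coef k) => E1 E0 recE.
rewrite -!scalemxAr -!scalemxAl !scalerA -!mulmxA -recE mulrBl.
rewrite mul1r !mulVf ?expf_neq0// scale1r.
by rewrite scalemxAr subrr.
Qed.

Lemma eta21_psum z : eta21 A B C q z = limn (psum eta_coef z).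
Proof.
congr (limn _); apply/funext => k; apply: eq_bigr => j _.
by rewrite /eta_coef scalerA.
Qed.

Lemma psum_eta_coef m (F0 : 'M[K]_(m, N)) z k :
  psum (fun j => F0 *m (q ^+ j *: eta_coef j)) z k
  = F0 *m psum eta_coef (q * z) k.
Proof.
rewrite /psum mulmx_sumr; apply: eq_bigr => j _.
by move: (eta_coef j) => E; rewrite -!scalemxAr scalerA exprMn mulrC.
Qed.

End Recurrence.

(** * Convergence of the series *)

Section RealBase.
Variables (R : realType) (q : R).
Hypothesis q01 : 0 < q < 1.

Lemma qC_neq0 : q%:C != 0.
Proof.
rewrite -(rmorph0 (real_complex R)) (inj_eq (@complexI R)) gt_eqF//.
by case/andP: q01.
Qed.

Lemma qC_not_root1 k : q%:C ^+ k.+1 != 1.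
Proof.
have /andP[q0 q1] := q01.
rewrite -rmorphXn -(rmorph1 (real_complex R)) (inj_eq (@complexI R)) lt_eqF//.
by rewrite exprn_ilt1// ltW.
Qed.

Lemma normc_qM z : normc (q%:C * z) = q * normc z.
Proof. by rewrite normcM normc_real gtr0_norm//; case/andP: q01. Qed.

End RealBase.

Section Convergence.
Variables (R : realType) (N : nat) (A B C : 'M[R[i]]_N).

(** Limit form of [psum_residual]: one statement serves both to verify that a
    series is a solution and to extract the recurrence from a solution. *)
Lemma cvg_psum_residual (q : R[i]) (f : nat -> 'rV[R[i]]_N) F z :
  q != 0 ->
  mx_cvg (psum f (q^-1 * z)) (F (q^-1 * z)) -> mx_cvg (psum f z) (F z) ->
  mx_cvg (psum f (q * z)) (F (q * z)) ->
  mx_cvg (fun k => z *: psum (residual A B C q f) z k)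
   ((1 - z) *: F (q^-1 * z) + F z *m (- 1%:M - C + z *: A)
    + F (q * z) *m (C + z *: B)).
Proof.
move=> q0 c1 c2 c3.
rewrite (_ : (fun _ => _) = (fun k =>
  psum f (q^-1 * z) k.+1 - z *: psum f (q^-1 * z) k
  + (psum f z k.+1 *m (- 1%:M - C) + z *: (psum f z k *m A))
  + (psum f (q * z) k.+1 *m C + z *: (psum f (q * z) k *m B)))); last first.
  by apply/funext => k; rewrite psum_residual.
rewrite !mulmxDr -!scalemxAr scalerBl scale1r -scaleNr -mulmxDr.
apply: cvg_mxD.
  apply: cvg_mxD.
    apply: cvg_mxD; first exact: cvg_mxS.
    by under eq_fun do rewrite -scaleNr; exact: cvg_mxZ.
  apply: cvg_mxD; first exact/cvg_mulmxr/cvg_mxS.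
  exact/cvg_mxZ/cvg_mulmxr.
apply: cvg_mxD; first exact/cvg_mulmxr/cvg_mxS.
exact/cvg_mxZ/cvg_mulmxr.
Qed.

Lemma ratio_geometric_bound (u : nat -> R) (x : R) K : 0 < x ->
  (forall k, (K <= k)%N -> u k.+1 <= x * u k) ->
  exists M, forall k, u k <= M * x ^+ k.
Proof.
move=> x0; elim: K u => [|K IH] u ux.
  exists (u 0) => k; elim: k => [|k IHk]; first by rewrite mulr1.
  by rewrite (le_trans (ux k _))// exprS mulrCA ler_pM2l.
have [M uM] := IH (fun k => u k.+1) (fun k Kk => ux k.+1 Kk).
exists (Num.max (u 0) (M / x)) => -[|k]; first by rewrite mulr1 le_max lexx.
apply: (le_trans (uM k)).
have -> : M * x ^+ k = M / x * x ^+ k.+1 by rewrite exprS mulrA divfK ?gt_eqF.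
by rewrite ler_pM2r ?exprn_gt0// le_max lexx orbT.
Qed.

(** One step of the ratio test.  Here [r] and [r'] stand for the norms of two
    consecutive coefficients, [W] for that of the second one times
    [1%:M - q ^+ k.+1 *: C], [y] for [q ^+ k], and [a], [b], [c] for the norms
    of [A], [B], [C].  Eliminating [W] gives
    (1 - y - y c) r' <= r (1 + y a + y b), and the smallness of [y] makes
    t (1 + y a + y b) at most x (1 - y - y c). *)
Lemma ratio_estimate (q a b c t x y r r' W : R) :
  0 <= q <= 1 -> 0 <= a -> 0 <= b -> 0 <= c -> 0 <= t -> x < 1 -> 0 <= y ->
  0 <= r -> 0 <= r' ->
  y * (1 + a + b + c) <= x - t ->
  (1 - q * y) * W <= r * (1 + y * a + y ^+ 2 * b) ->
  r' <= W + q * y * c * r' -> t * r' <= x * r.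
Proof.
move=> /andP[q0 q1] a0 b0 c0 t0 x1 y0 r0 r'0 yx recW W_r'.
have [ya yb yc] : [/\ 0 <= y * a, 0 <= y * b & 0 <= y * c].
  by rewrite !mulr_ge0.
have sum_le : y + y * a + y * b + y * c <= x - t by lra.
have qy : q * y <= y by rewrite ler_piMl.
have qyc : q * y * c <= y * c by rewrite ler_wpM2r.
have h2 : (1 - y * c) * r' <= W.
  have : q * y * c * r' <= y * c * r' by rewrite ler_wpM2r.
  by lra.
have W0 : 0 <= W by apply: le_trans h2; rewrite mulr_ge0//; lra.
have y2b : y ^+ 2 * b <= y * b by rewrite expr2 -mulrA ler_piMl//; lra.
have h1 : (1 - y) * W <= r * (1 + y * a + y * b).
  have : q * y * W <= y * W by rewrite ler_wpM2r.
  have : r * (1 + y * a + y ^+ 2 * b) <= r * (1 + y * a + y * b).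
    by rewrite ler_wpM2l// lerD2l.
  by lra.
have h3 : (1 - y) * ((1 - y * c) * r') <= (1 - y) * W.
  by rewrite ler_wpM2l//; lra.
have ycr : 0 <= y * (y * c * r') by rewrite !mulr_ge0.
have h4 : (1 - y - y * c) * r' <= r * (1 + y * a + y * b) by lra.
have D0 : 0 < 1 - y - y * c by lra.
rewrite -(ler_pM2r D0).
have h5 : t * ((1 - y - y * c) * r') <= t * (r * (1 + y * a + y * b)).
  by rewrite ler_wpM2l.
have h6 : r * (t * (1 + y * a + y * b)) <= r * (x * (1 - y - y * c)).
  rewrite ler_wpM2l//.
  have : t * (y * a + y * b) <= y * a + y * b.
    by rewrite ler_piMl ?addr_ge0//; lra.
  have : x * (y + y * c) <= y + y * c by rewrite ler_piMl ?addr_ge0//; lra.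
  by lra.
lra.
Qed.

(** For [t] below 1, take [x] strictly between [t] and 1: the ratio of
    consecutive terms of the sequence has an upper bound tending to [t], so it
    is eventually at most [x], and a geometric bound follows. *)
Lemma eta_coef_growth (q t : R) : 0 < q < 1 -> 0 <= t < 1 ->
  (forall k, 1%:M - q%:C ^+ k.+1 *: C \in unitmx) ->
  exists M x, 0 <= x < 1 /\
    forall k, t ^+ k * mnorm (eta_coef A B C q%:C k) <= M * x ^+ k.
Proof.
move=> q01 /andP[t0 t1] unitC; have /andP[q0 q1] := q01.
pose x := (1 + t) / 2; pose D := 1 + mnorm A + mnorm B + mnorm C.
have D0 : 0 < D by rewrite /D -!addrA ltr_pwDl// !addr_ge0 ?mnorm_ge0.
have [K _ qK] : \forall k \near \oo, q ^+ k < (x - t) / D.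
  have : geometric 1 q k @[k --> \oo] --> (0 : R).
    by apply: cvg_geometric; rewrite gtr0_norm.
  move=> /cvgr0Pnorm_lt/(_ ((x - t) / D)); rewrite divr_gt0//; last first.
    by rewrite /x; lra.
  move=> /(_ isT); apply: filterS => k /=.
  by rewrite mul1r ger0_norm// exprn_ge0// ltW.
have x0 : 0 < x by rewrite /x; lra.
have q_nr := qC_not_root1 q01.
have [|M uM] := @ratio_geometric_bound
  (fun k => t ^+ k * mnorm (eta_coef A B C q%:C k)) x K x0.
  move=> k Kk; rewrite exprSr -mulrA [leRHS]mulrCA ler_wpM2l ?exprn_ge0//.
  have := @eta_coefS _ _ A B C q%:C q_nr unitC k.
  move: (eta_coef _ _ _ _ k.+1) (eta_coef _ _ _ _ k) => E1 E0 recE.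
  have normq j : normc (q%:C ^+ j) = q ^+ j.
    by rewrite normcX normc_real gtr0_norm.
  apply: (@ratio_estimate q (mnorm A) (mnorm B) (mnorm C) t x (q ^+ k)
    (mnorm E0) (mnorm E1) (mnorm (E1 *m (1%:M - q%:C ^+ k.+1 *: C))));
    rewrite ?mnorm_ge0 ?exprn_ge0 ?(ltW q0) ?(ltW q1)//.
  - by rewrite /x; lra.
  - by rewrite -/D -ler_pdivlMr// ltW// qK.
  - have -> : (1 - q * q ^+ k) = normc (1 - q%:C ^+ k.+1).
      rewrite -rmorphXn -(rmorph1 (real_complex R)) -rmorphB normc_real exprS.
      by rewrite ger0_norm// subr_ge0 -exprS exprn_ile1 ?ltW.
    rewrite -mnormZ recE !mulmxBr mulmx1 -!scalemxAr.
    rewrite (le_trans (mnormB _ _))// !mulrDr mulr1 lerD//.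
      rewrite (le_trans (mnormB _ _))// lerD// mnormZ normq mulrCA.
      by rewrite ler_wpM2l ?exprn_ge0 ?mnormM// ltW.
    rewrite mnormZ normq mulrCA mulnC exprM.
    by rewrite ler_wpM2l ?exprn_ge0 ?mnormM// ltW.
  - rewrite -exprS -mulrA [mnorm C * _]mulrC.
    have {1}-> : E1 = E1 *m (1%:M - q%:C ^+ k.+1 *: C)
        + q%:C ^+ k.+1 *: (E1 *m C).
      by rewrite mulmxBr mulmx1 -scalemxAr subrK.
    rewrite (le_trans (mnormD _ _))// lerD2l mnormZ normq.
    by rewrite ler_wpM2l ?exprn_ge0 ?mnormM// ltW.
exists M, x; split=> //; rewrite /x; lra.
Qed.

Lemma cvg_psum_eta_coef (q : R) (z : R[i]) : 0 < q < 1 -> normc z < 1 ->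
  (forall k, 1%:M - q%:C ^+ k.+1 *: C \in unitmx) ->
  mx_cvg (psum (eta_coef A B C q%:C) z) (eta21 A B C q%:C z).
Proof.
move=> q01 z1 unitC.
have z01 : 0 <= normc z < 1 by rewrite normc_ge0.
have [M [x [x01 zM]]] := eta_coef_growth q01 z01 unitC.
have [|l cl] := @cvg_mx_dominated R _ _
  (fun k => z ^+ k *: eta_coef A B C q%:C k) M x x01.
  by move=> k; rewrite mnormZ normcX.
by rewrite eta21_psum (cvg_mx_lim cl).
Qed.

End Convergence.

(** * Analytic solutions of the equation *)

Lemma unitmx_spectrum (K : numFieldType) N (C : 'M[K]_N) (a : K) :
  a != 0 -> ~ spectrum C a^-1 -> 1%:M - a *: C \in unitmx.
Proof.
move=> a0; rewrite /spectrum/= /eigenvalue => /negP/negPn kerC.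
have -> : 1%:M - a *: C = - a *: (C - a^-1%:M).
  rewrite scalerBr scale_scalar_mx mulNr divff// scaleNr raddfN/= opprK.
  by rewrite addrC.
by rewrite unitmxZ ?unitrN ?unitfE// -row_free_unit -kermx_eq0.
Qed.

Section Solutions.
Variables (R : realType) (N : nat) (A B C : 'M[R[i]]_N) (q : R).
Hypothesis q01 : 0 < q < 1.
Hypothesis unitC : forall k, 1%:M - q%:C ^+ k.+1 *: C \in unitmx.

Lemma eta21_0 : eta21 A B C q%:C 0 = 1%:M.
Proof.
have c0 : mx_cvg (psum (eta_coef A B C q%:C) 0) (eta21 A B C q%:C 0).
  by apply: cvg_psum_eta_coef; rewrite ?normc0.
by rewrite (cvg_psum_at0 c0) eta_coef0.
Qed.

Lemma eta21_qdiff (F0 : 'rV[R[i]]_N) z : normc z < 1 ->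
  qdiff_eq A B C q%:C (fun z => F0 *m eta21 A B C q%:C (q%:C * z)) z.
Proof.
move=> z1; have /andP[q0 q1] := q01.
pose f j := F0 *m (q%:C ^+ j *: eta_coef A B C q%:C j).
have cf w : normc (q%:C * w) < 1 ->
    mx_cvg (psum f w) (F0 *m eta21 A B C q%:C (q%:C * w)).
  move=> w1; rewrite (_ : psum f w =
    fun k => F0 *m psum (eta_coef A B C q%:C) (q%:C * w) k).
    exact/cvg_mulmxl/cvg_psum_eta_coef.
  by apply/funext => k; exact: psum_eta_coef.
have qz1 : normc (q%:C * z) < 1.
  by rewrite (normc_qM q01); have := normc_ge0 z; nra.
apply: (@cvg_mx_unique _ _ _
  (fun k => z *: psum (residual A B C q%:C f) z k)).
  apply: (cvg_psum_residual
    (F := fun w => F0 *m eta21 A B C q%:C (q%:C * w))).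
  - exact: qC_neq0 q01.
  - by apply: cf; rewrite mulVKf ?(qC_neq0 q01).
  - exact: cf.
  - by apply: cf; rewrite (normc_qM q01); have := normc_ge0 (q%:C * z); nra.
rewrite (_ : (fun _ => _) = fun=> 0); first exact: cvg_cst.
apply/funext => k; rewrite /psum big1 ?scaler0// => j _.
by rewrite residual_eta_coef ?(qC_neq0 q01) ?scaler0//; exact: qC_not_root1 q01.
Qed.

Lemma qdiff_eta21 (r : R) (F : R[i] -> 'rV[R[i]]_N) :
  0 < r -> analytic_on_disc r%:C F ->
  (\forall z \near (0 : R[i]^o), qdiff_eq A B C q%:C F z) ->
  forall z : R[i], normc z < r -> normc (q%:C * z) < 1 ->
    F z = F 0 *m eta21 A B C q%:C (q%:C * z).
Proof.
move=> r0 [f cf] /nbhs_ballP[e /= e0 eqF]; have /andP[q0 q1] := q01.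
have {}cf z : normc z < r -> mx_cvg (psum f z) (F z).
  by move=> zr; apply: cf; rewrite norm_normc ltcR.
have eE : e = (complex.Re e)%:C by rewrite RRe_real// gtr0_real.
rewrite eE ltcR in e0.
(* The bound [q * r] keeps [q^-1 * z] inside the disc of radius [r]. *)
pose d := Num.min (complex.Re e) (q * r).
have d0 : 0 < d by rewrite lt_min e0 mulr_gt0.
have res0 : forall k, residual A B C q%:C f k = 0.
  apply: (psum_coef0 d0) => z /andP[z0]; rewrite lt_min => /andP[ze zqr].
  have z_neq0 : z != 0 by apply: contraTneq z0 => ->; rewrite normc0 ltxx.
  have eqFz : qdiff_eq A B C q%:C F z.
    by apply: eqF; rewrite /ball/= sub0r normrN norm_normc eE ltcR.
  have zr : normc z < r by nra.
  have c : mx_cvg (fun k => z *: psum (residual A B C q%:C f) z k) 0.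
    rewrite -eqFz; apply: cvg_psum_residual; rewrite ?(qC_neq0 q01)//;
      apply: cf => //.
      rewrite normcM normcV normc_real gtr0_norm// mulrC ltr_pdivrMr//.
      by rewrite mulrC.
    by rewrite (normc_qM q01); nra.
  have := cvg_mxZ (a := z^-1) c; rewrite scaler0; congr mx_cvg.
  by apply/funext => k; rewrite scalerA mulVf// scale1r.
have f0E : f 0 = F 0.
  by apply/esym/cvg_psum_at0/cf; rewrite normc0.
have fE : f =1 fun j => F 0 *m (q%:C ^+ j *: eta_coef A B C q%:C j).
  apply: (residual_inj _ _ res0) => //.
  - exact: qC_not_root1 q01.
  - move=> k; apply: residual_eta_coef => //; first exact: qC_neq0 q01.
    exact: qC_not_root1 q01.
  - by rewrite expr0 scale1r eta_coef0 mulmx1.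
move=> z zr qz1; apply: (cvg_mx_unique (cf z zr)).
rewrite (_ : psum f z =
  fun k => F 0 *m psum (eta_coef A B C q%:C) (q%:C * z) k).
  exact/cvg_mulmxl/cvg_psum_eta_coef.
apply/funext => k; rewrite -psum_eta_coef.
by apply: eq_bigr => j _; rewrite fE.
Qed.

End Solutions.

Theorem theorem4p2 (R : realType) (q : R) (N : nat) (A B C : 'M[R[i]]_N) :
  0 < q < 1 ->
  (1 <= N)%N ->
  spectrum C `&` [set q%:C ^- n | n in [set n : nat | (0 < n)%N]] = set0 ->
  (forall F0 : 'rV[R[i]]_N,
     let F := fun z : R[i] => F0 *m eta21 A B C q%:C (q%:C * z) in
     F 0 = F0 /\
     forall z : R[i], `|z| < 1 -> qdiff_eq A B C q%:C F z) /\
  (forall (r : R) (F : R[i] -> 'rV[R[i]]_N),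
     0 < r ->
     analytic_on_disc r%:C F ->
     (\forall z \near (0 : R[i]^o), qdiff_eq A B C q%:C F z) ->
     F 0 != 0 ->
     exists F0 : 'rV[R[i]]_N,
       forall z : R[i], `|z| < r%:C -> `|q%:C * z| < 1 ->
         F z = F0 *m eta21 A B C q%:C (q%:C * z)).
Proof.
move=> q01 _ specC.
have unitC k : 1%:M - q%:C ^+ k.+1 *: C \in unitmx.
  apply: unitmx_spectrum; first by rewrite expf_neq0 ?(qC_neq0 q01).
  move=> Cq; suff : (set0 : set R[i]) (q%:C ^- k.+1) by [].
  by rewrite -specC; split=> //; exists k.+1.
have norm_lt1 (z : R[i]) : `|z| < 1 -> normc z < 1 by rewrite norm_normc ltcR.
split=> [F0 F|r F r0 F_an F_eq _].
  split=> [|z z1]; first by rewrite /F mulr0 eta21_0// mulmx1.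
  exact: eta21_qdiff (norm_lt1 z z1).
exists (F 0) => z; rewrite norm_normc ltcR => zr /norm_lt1 qz1.
exact: qdiff_eta21 F_an F_eq _ zr qz1.
Qed.
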